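(* Let $A\in\mathbb{C}^{m\times n}$ have rank $r$ and let $G\in\mathbb{C}^{n\times m}$ have rank $s$ with $0<s\le r$, such that $\operatorname{rank}(GA)=\operatorname{rank}(G)$. Put $T=R(G)$ and $S=N(G)$. Then the sequence of matrix approximations $\{X_k\}_{k\ge 0}$ defined by the iteration (PM) described in the context converges to $A^{(2)}_{T,S}=A^{(2)}_{R(G),N(G)}$ with the eighteenth order of convergence if the initial value $X_0=\alpha G$ ($\alpha$ a nonzero real scalar) satisfies $$\left\|A A^{(2)}_{T,S}-A X_0\right\|<1,$$ where $\|\cdot\|$ denotes the spectral matrix norm.
   Context: For a matrix $M$, $R(M)$ denotes its range and $N(M)$ its null space. For subspaces $T\subseteq\mathbb{C}^n$, $S\subseteq\mathbb{C}^m$, $A^{(2)}_{T,S}$ denotes the outer generalized inverse of $A$ with range $T$ and null space $S$, i.e. the matrix $X\in\mathbb{C}^{n\times m}$ with $XAX=X$, $R(X)=T$, $N(X)=S$. Iteration (PM): with $I=I_m$, for $k=0,1,2,\dots$, $$R_k=I-AX_k,\qquad M_k=(I+c_1R_k^2+R_k^4)(I+c_2R_k^2+R_k^4),$$ $$T_k=M_k+c_3R_k^2,\qquad S_k=M_k+d_1R_k^2+d_2R_k^4,$$ $$X_{k+1}=X_k\,(I+R_k)\,\bigl(T_kS_k+\mu R_k^2+\psi R_k^4\bigr),$$ with constants $$c_1=\tfrac14\Bigl(1+\sqrt{27-2\sqrt{93}}\Bigr),\quad c_2=\tfrac14\Bigl(1-\sqrt{27-2\sqrt{93}}\Bigr),\quad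 c_3=\tfrac{1}{496}\bigl(5\sqrt{93}-93\bigr),$$ $$d_1=\tfrac{1}{496}\bigl(-93-5\sqrt{93}\bigr),\quad d_2=-\tfrac{\sqrt{93}}{4},\quad \mu=\tfrac38,\quad \psi=\tfrac{321}{1984}.$$ (The matrices $T_k,S_k$ of the iteration are unrelated to the subspaces $T,S$.)
   Formalization: The existence of the outer inverse of A with range R(G) and null space N(G) is assumed, since rank(GA)=rank(G) does not imply it: for A=[[0,1],[1,0]], G=diag(1,0) the rank condition holds but no such inverse exists. *)

(* Defs.v *)
From HB Require Import structures.
From mathcomp Require Import all_boot all_order all_algebra.
From mathcomp Require Import complex.
From mathcomp Require Import all_classical all_reals all_analysis.

Set Implicit Arguments.
Unset Strict Implicit.
Unset Printing Implicit Defensive.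
Import Order.TTheory GRing.Theory Num.Theory.
Import numFieldNormedType.Exports.
Import ComplexField.Normc.
Local Open Scope classical_set_scope.
Local Open Scope complex_scope.
Local Open Scope ring_scope.

(* The field of complex numbers is R[i] with R : realType. Matrices act on
   column vectors, as x |-> M *m x. *)

Definition mxrange (F : fieldType) (m n : nat) (M : 'M[F]_(m, n)) :
  {vspace 'cV[F]_m} := limg (linfun (mulmx M : 'cV[F]_n -> 'cV[F]_m)).

Definition mxnull (F : fieldType) (m n : nat) (M : 'M[F]_(m, n)) :
  {vspace 'cV[F]_n} := lker (linfun (mulmx M : 'cV[F]_n -> 'cV[F]_m)).

Lemma mem_mxrange (F : fieldType) (m n : nat) (M : 'M[F]_(m, n)) y :
  y \in mxrange M <-> exists x : 'cV[F]_n, y = M *m x.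
Proof.
split=> [/memv_imgP[x _ ->]|[x ->]]; first by exists x; rewrite lfunE.
by have := memv_img (linfun (mulmx M)) (memvf x); rewrite lfunE.
Qed.

Lemma mem_mxnull (F : fieldType) (m n : nat) (M : 'M[F]_(m, n)) x :
  x \in mxnull M <-> M *m x = 0.
Proof. by rewrite memv_ker lfunE; split=> /eqP. Qed.

(* X is the outer inverse of A with prescribed range T and null space S. It
   need not exist for given T and S, but there is at most one:
   outer_inverse_unique. *)
Definition is_outer_inverse (F : fieldType) (m n : nat) (A : 'M[F]_(m, n))
    (T : {vspace 'cV[F]_n}) (S : {vspace 'cV[F]_m}) (X : 'M[F]_(n, m)) : Prop :=
  [/\ X *m A *m X = X, mxrange X = T & mxnull X = S].

Lemma outer_inverse_unique (F : fieldType) (m n : nat) (A : 'M[F]_(m, n)) T S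
    (X Y : 'M[F]_(n, m)) :
  is_outer_inverse A T S X -> is_outer_inverse A T S Y -> X = Y.
Proof.
move=> [XAX RX NX] [YAY RY NY].
have ext (B B' : 'M[F]_(n, m)) : (forall v : 'cV_m, B *m v = B' *m v) -> B = B'.
  move=> h; apply/matrixP => i j; have := h (delta_mx j 0).
  by rewrite -!colE => /matrixP/(_ i 0); rewrite !mxE.
transitivity (Y *m A *m X); apply: ext => v.
  have /mem_mxrange[w Xv] : X *m v \in mxrange Y.
    by rewrite RY -RX; apply/mem_mxrange; exists v.
  by rewrite -mulmxA Xv mulmxA YAY.
have /mem_mxnull : v - A *m (X *m v) \in mxnull Y.
  by rewrite NY -NX; apply/mem_mxnull; rewrite mulmxBr !mulmxA XAX subrr.
by rewrite mulmxBr => /subr0_eq ->; rewrite !mulmxA.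
Qed.

Definition l2norm (R : realType) (n : nat) (x : 'cV[R[i]]_n) : R :=
  Num.sqrt (\sum_(j < n) normc (x j 0) ^+ 2).

Definition specnorm (R : realType) (m n : nat) (M : 'M[R[i]]_(m, n)) : R :=
  sup [set l2norm (M *m x) | x in [set x : 'cV[R[i]]_n | l2norm x <= 1]].

(* sup is 0 by convention on a set that is empty or unbounded above; this does
   not occur in specnorm. *)
Lemma specnorm_has_sup (R : realType) (m n : nat) (M : 'M[R[i]]_(m, n)) :
  has_sup [set l2norm (M *m x) | x in [set x : 'cV[R[i]]_n | l2norm x <= 1]].
Proof.
split.
  exists (l2norm (M *m 0)), 0 => //=.
  rewrite /l2norm big1 ?sqrtr0 ?ler01// => j _.
  by rewrite mxE normc0 expr0n.
exists (Num.sqrt (\sum_(i < m) (\sum_(j < n) normc (M i j)) ^+ 2)).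
have normc_ge0 (z : R[i]) : 0 <= normc z by case: z => a b; exact: sqrtr_ge0.
move=> _ [x /= x1 <-]; rewrite ler_sqrt; last first.
  by apply: sumr_ge0 => i _; exact: sqr_ge0.
have xj j : normc (x j 0) <= 1.
  apply: le_trans x1; rewrite -[leLHS]ger0_norm// -sqrtr_sqr ler_sqrt; last first.
    by apply: sumr_ge0 => k _; exact: sqr_ge0.
  by rewrite (bigD1 j)//= lerDl sumr_ge0// => k _; exact: sqr_ge0.
apply: ler_sum => i _; rewrite lerXn2r ?nnegrE ?sumr_ge0// mxE.
elim/big_ind2 : _ => //; first by rewrite normc0.
  by move=> a b c d ab cd; rewrite (le_trans (le_normcD _ _))// lerD.
by move=> j _; rewrite normcM ler_piMr.
Qed.

(* Convergence in norm, with order (at least) p. *)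
Definition converges_with_order (R : realType) (m n : nat) (p : nat)
    (X : nat -> 'M[R[i]]_(m, n)) (L : 'M[R[i]]_(m, n)) : Prop :=
  (fun k => specnorm (X k - L)) @ \oo --> (0 : R) /\
  exists2 C : R, 0 < C &
    forall k, specnorm (X k.+1 - L) <= C * specnorm (X k - L) ^+ p.

Definition pm_c1 (R : realType) : R :=
  1 / 4 * (1 + Num.sqrt (27 - 2 * Num.sqrt 93)).
Definition pm_c2 (R : realType) : R :=
  1 / 4 * (1 - Num.sqrt (27 - 2 * Num.sqrt 93)).
Definition pm_c3 (R : realType) : R := 1 / 496 * (5 * Num.sqrt 93 - 93).
Definition pm_d1 (R : realType) : R := 1 / 496 * (- 93 - 5 * Num.sqrt 93).
Definition pm_d2 (R : realType) : R := - (Num.sqrt 93 / 4).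
Definition pm_mu (R : realType) : R := 3 / 8.
Definition pm_psi (R : realType) : R := 321 / 1984.

Definition pm_step (R : realType) (m n : nat) (A : 'M[R[i]]_(m, n))
    (X : 'M[R[i]]_(n, m)) : 'M[R[i]]_(n, m) :=
  let I : 'M[R[i]]_m := 1%:M in
  let Rk : 'M[R[i]]_m := I - A *m X in
  let Mk := (I + (pm_c1 R)%:C *: Rk ^+ 2 + Rk ^+ 4) *m
            (I + (pm_c2 R)%:C *: Rk ^+ 2 + Rk ^+ 4) in
  let Tk := Mk + (pm_c3 R)%:C *: Rk ^+ 2 in
  let Sk := Mk + (pm_d1 R)%:C *: Rk ^+ 2 + (pm_d2 R)%:C *: Rk ^+ 4 in
  X *m (I + Rk) *m
    (Tk *m Sk + (pm_mu R)%:C *: Rk ^+ 2 + (pm_psi R)%:C *: Rk ^+ 4).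

Definition pm_iter (R : realType) (m n : nat) (A : 'M[R[i]]_(m, n))
    (X0 : 'M[R[i]]_(n, m)) (k : nat) : 'M[R[i]]_(n, m) :=
  iter k (pm_step A) X0.

(* Main.v *)
(* The constants are tuned so that (I + R)(T S + mu R^2 + psi R^4) is exactly
   I + R + ... + R^17. Writing L for the outer inverse, P = A L, and
   D_k = A (L - X_k), the residual is R_k = (I - P) + D_k, with I - P idempotent
   and annihilating D_k on both sides. Hence A X_{k+1} = I - R_k^18 gives
   D_{k+1} = D_k^18, while L - X_k = L D_k; submultiplicativity of the spectral
   norm yields both the convergence and its order. *)
Require Import Defs.
From mathcomp Require Import all_boot all_order all_algebra.
From mathcomp Require Import complex ring lra zify.
From mathcomp Require Import all_classical all_reals all_analysis.
Import Order.TTheory GRing.Theory Num.Theory.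
Import numFieldNormedType.Exports.
Import ComplexField.Normc.
Local Open Scope complex_scope.
Local Open Scope ring_scope.

Lemma l2norm_ge0 {R : realType} {n} (x : 'cV[R[i]]_n) : 0 <= l2norm x.
Proof. exact: sqrtr_ge0. Qed.

Lemma l2normZ {R : realType} {n} (a : R[i]) (x : 'cV[R[i]]_n) :
  l2norm (a *: x) = normc a * l2norm x.
Proof.
have na : 0 <= normc a by case: a => u v; exact: sqrtr_ge0.
rewrite /l2norm -[X in X * _]ger0_norm// -sqrtr_sqr -sqrtrM ?sqr_ge0// mulr_sumr.
by congr Num.sqrt; apply: eq_bigr => j _; rewrite mxE normcM exprMn.
Qed.

Lemma l2norm_eq0 {R : realType} {n} (x : 'cV[R[i]]_n) : l2norm x = 0 -> x = 0.
Proof.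
move=> /eqP; rewrite sqrtr_eq0 => x0; apply/matrixP => j k; rewrite ord1 mxE.
apply: eq0_normc; apply/eqP; rewrite -sqrf_eq0 eq_le sqr_ge0 andbT.
by apply: le_trans x0; rewrite (bigD1 j)//= lerDl sumr_ge0// => l _; exact: sqr_ge0.
Qed.

Lemma specnorm_ub {R : realType} {m n} (M : 'M[R[i]]_(m, n)) x :
  l2norm x <= 1 -> l2norm (M *m x) <= specnorm M.
Proof.
move=> x1; apply: ub_le_sup; first exact: (specnorm_has_sup M).2.
by exists x.
Qed.

Lemma specnorm_ge0 {R : realType} {m n} (M : 'M[R[i]]_(m, n)) : 0 <= specnorm M.
Proof.
apply: le_trans (specnorm_ub _ 0 _); first exact: l2norm_ge0.
by rewrite -(scale0r 0) l2normZ normc0 mul0r.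
Qed.

(** Homogeneity reduces a nonzero [x] to the unit vector [x / l2norm x], where [specnorm_ub]
    applies. *)
Lemma l2norm_mul {R : realType} {m n} (M : 'M[R[i]]_(m, n)) x :
  l2norm (M *m x) <= specnorm M * l2norm x.
Proof.
have [/eqP/l2norm_eq0 ->|x0] := boolP (l2norm x == 0).
  by rewrite mulmx0 -(scale0r 0) l2normZ normc0 mul0r mulr_ge0 ?specnorm_ge0 ?l2norm_ge0.
have x_gt0 : 0 < l2norm x by rewrite lt0r x0 l2norm_ge0.
have normcV : normc ((l2norm x)^-1)%:C = (l2norm x)^-1.
  by rewrite /= expr0n addr0 sqrtr_sqr ger0_norm// invr_ge0 ltW.
rewrite -ler_pdivrMr// mulrC -normcV -l2normZ scalemxAr specnorm_ub//.
by rewrite l2normZ normcV mulVf.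
Qed.

Lemma specnorm_le {R : realType} {m n} (M : 'M[R[i]]_(m, n)) c :
  (forall x, l2norm x <= 1 -> l2norm (M *m x) <= c) -> specnorm M <= c.
Proof.
move=> Mc; apply: ge_sup; first exact: (specnorm_has_sup M).1.
by move=> _ [x /= x1 <-]; exact: Mc.
Qed.

Lemma specnormM {R : realType} {m n p} (M : 'M[R[i]]_(m, n)) (N : 'M[R[i]]_(n, p)) :
  specnorm (M *m N) <= specnorm M * specnorm N.
Proof.
apply: specnorm_le => x x1; rewrite -mulmxA (le_trans (l2norm_mul _ _))//.
by rewrite ler_wpM2l ?specnorm_ge0// specnorm_ub.
Qed.

Lemma specnormN {R : realType} {m n} (M : 'M[R[i]]_(m, n)) : specnorm (- M) = specnorm M.
Proof.
congr sup; apply: eq_imagel => x _; congr Num.sqrt.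
by apply: eq_bigr => j _; rewrite mulNmx mxE normcN.
Qed.

Lemma specnormX {R : realType} {m} (M : 'M[R[i]]_m) k :
  specnorm (M ^+ k.+1) <= specnorm M ^+ k.+1.
Proof.
elim: k => [|k IH]; first by rewrite !expr1.
rewrite exprS [leRHS]exprS (le_trans (specnormM _ _))//.
by rewrite ler_wpM2l ?specnorm_ge0.
Qed.

(* The left-hand sides are the coefficients of w, ..., w^7 in
   T S + mu w + psi w^2, where w = R^2. *)
Lemma pm_coefs_eq1 (R : realType) (p := pm_c1 R + pm_c2 R) (q := 2 + pm_c1 R * pm_c2 R)
    (b := pm_c3 R + pm_d1 R) :
  [/\ 2 * p + b + pm_mu R = 1,
      p ^+ 2 + 2 * q + p * b + pm_d2 R + pm_c3 R * pm_d1 R + pm_psi R = 1,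
      2 * p * (1 + q) + q * b + p * pm_d2 R + pm_c3 R * pm_d2 R = 1
      & [/\ 2 + 2 * p ^+ 2 + q ^+ 2 + p * b + q * pm_d2 R = 1,
      2 * p * (1 + q) + b + p * pm_d2 R = 1,
      p ^+ 2 + 2 * q + pm_d2 R = 1 &
      2 * p = 1]].
Proof.
pose s : R := Num.sqrt 93.
have s2 : s ^+ 2 = 93 by rewrite sqr_sqrtr// ler0n.
(* This keeps the radicand [27 - 2 * s] nonnegative, so its root is genuine rather than the default
   0. That root enters [q] only through its square. *)
have s_le : s <= 27 / 2.
  rewrite -(@ler_pXn2r _ 2)// ?nnegrE ?sqrtr_ge0// ?s2; lra.
have t2 : Num.sqrt (27 - 2 * s) ^+ 2 = 27 - 2 * s by rewrite sqr_sqrtr//; lra.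
have pE : p = 1 / 2 by rewrite /p /pm_c1 /pm_c2; field.
have qE : q = (3 + s) / 8.
  transitivity (2 + (1 - Num.sqrt (27 - 2 * s) ^+ 2) / 16).
    by rewrite /q /pm_c1 /pm_c2 -/s; field.
  by rewrite t2; field.
have bE : b = - (3 / 8) by rewrite /b /pm_c3 /pm_d1; field.
rewrite pE qE bE /pm_c3 /pm_d1 /pm_d2 /pm_mu /pm_psi -/s.
split; last split; lra.
Qed.

(** After the factor [1 + x], the expression is a polynomial in [x ^+ 2] of degree 8 with all
    coefficients 1. Working over any commutative [K] leaves the expansion to [ring]. *)
Lemma pm_poly_geometric (R : realType) (K : comNzRingType) (f : {rmorphism R -> K}) (x : K) :
  let M := (1 + f (pm_c1 R) * x ^+ 2 + x ^+ 4) * (1 + f (pm_c2 R) * x ^+ 2 + x ^+ 4) in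
  (1 + x) * ((M + f (pm_c3 R) * x ^+ 2) *
    (M + f (pm_d1 R) * x ^+ 2 + f (pm_d2 R) * x ^+ 4)
    + f (pm_mu R) * x ^+ 2 + f (pm_psi R) * x ^+ 4) = \sum_(i < 18) x ^+ i.
Proof.
have [] := pm_coefs_eq1 R.
set p := pm_c1 R + pm_c2 R; set q := 2 + pm_c1 R * pm_c2 R.
set b := pm_c3 R + pm_d1 R => e1 e2 e3 [e4 e5 e6 e7] M.
(* Each coefficient is gathered under a single [f], so that the equations [e1] to [e7] rewrite it to
   [f 1]. *)
transitivity ((1 + x) * (1 + f (2 * p + b + pm_mu R) * x ^+ 2
  + f (p ^+ 2 + 2 * q + p * b + pm_d2 R + pm_c3 R * pm_d1 R + pm_psi R) * x ^+ 4
  + f (2 * p * (1 + q) + q * b + p * pm_d2 R + pm_c3 R * pm_d2 R) * x ^+ 6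
  + f (2 + 2 * p ^+ 2 + q ^+ 2 + p * b + q * pm_d2 R) * x ^+ 8
  + f (2 * p * (1 + q) + b + p * pm_d2 R) * x ^+ 10
  + f (p ^+ 2 + 2 * q + pm_d2 R) * x ^+ 12
  + f (2 * p) * x ^+ 14 + x ^+ 16)).
  by rewrite /M /p /q /b; ring.
by rewrite e1 e2 e3 e4 e5 e6 e7 rmorph1 !big_ord_recr big_ord0 /=; ring.
Qed.

Lemma pm_step_geometric {R : realType} {m n} (A : 'M[R[i]]_(m, n)) (X : 'M[R[i]]_(n, m)) :
  pm_step A X = X *m \sum_(i < 18) (1%:M - A *m X) ^+ i.
Proof.
(* For [m = 0] both sides have no columns; otherwise the square matrices form a nontrivial algebra,
   where polynomials can be evaluated. *)
case: m A X => [|m] A X; first by rewrite [LHS]thinmx0 [RHS]thinmx0.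
rewrite /pm_step -!mulmxA; congr (_ *m _).
set r := 1%:M - A *m X.
(* Matrices do not commute, so the identity is taken in [{poly R[i]}] and then evaluated at [r]. *)
have := pm_poly_geometric R {poly R[i]} (polyC \o real_complex R) 'X.
move=> /(congr1 (horner_alg r)).
rewrite rmorph_sum/= (eq_bigr (fun i : 'I_18 => r ^+ i)); last first.
  by move=> i _; rewrite rmorphXn/= horner_algX.
move=> <-.
(* Abstract constants, which the [rmorph] lemmas would otherwise unfold. *)
move: (pm_c1 R) (pm_c2 R) (pm_c3 R) (pm_d1 R) (pm_d2 R) (pm_mu R) (pm_psi R) r.
move=> c1 c2 c3 d1 d2 mu psi r.
rewrite !(rmorphM, rmorphD, rmorph1, rmorphXn)/= !horner_algC !horner_algX.
by rewrite !mulr_algl -!mulmxE.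
Qed.

(** The mixed terms vanish in every power of [(1 - P) + D]. The exponent starts at 1, since at 0 the
    right-hand side would be [1 - P + 1]. *)
Lemma residual_power {F : fieldType} {m n : nat} (A : 'M[F]_(m, n)) (L X : 'M[F]_(n, m))
    (P := A *m L) (D := A *m (L - X)) k :
  L *m A *m L = L -> L *m A *m X = X -> X *m A *m L = X ->
  (1%:M - A *m X) ^+ k.+1 = 1%:M - P + D ^+ k.+1.
Proof.
move=> LAL LAX XAL.
have PP : P * P = P by rewrite -mulmxE /P mulmxA -(mulmxA A) -mulmxA LAL.
have PD : P * D = D by rewrite -mulmxE /P /D mulmxA -(mulmxA A) -mulmxA mulmxBr LAL LAX.
have DP : D * P = D by rewrite -mulmxE /P /D mulmxA -(mulmxA A) -mulmxA !mulmxBl LAL XAL.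
pose Q : 'M[F]_m := 1 - P.
have QQ : Q * Q = Q by rewrite /Q mulrBl mul1r mulrBr mulr1 PP subrr subr0.
have QD : Q * D = 0 by rewrite /Q mulrBl mul1r PD subrr.
have DQ : D * Q = 0 by rewrite /Q mulrBr mulr1 DP subrr.
have rE : 1%:M - A *m X = Q + D by rewrite /D mulmxBr addrA subrK.
change (1%:M - P) with Q; clearbody Q; elim: k => [|k IH]; first by rewrite !expr1.
rewrite exprS IH rE mulrDl !mulrDr QQ DQ add0r -exprS.
by rewrite [D ^+ k.+1]exprS mulrA QD mul0r addr0.
Qed.

(** The two absorption identities for [X] pass on to [Y], so the step can be iterated. The error
    formula comes from telescoping the geometric sum. *)
Lemma geometric_residual {F : fieldType} {m n : nat} (A : 'M[F]_(m, n)) (L X : 'M[F]_(n, m))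
    (P := A *m L) (D := A *m (L - X))
    k (Y := X *m \sum_(i < k.+1) (1%:M - A *m X) ^+ i) :
  L *m A *m L = L -> L *m A *m X = X -> X *m A *m L = X ->
  [/\ L *m A *m Y = Y, Y *m A *m L = Y & A *m (L - Y) = D ^+ k.+1].
Proof.
move=> LAL LAX XAL; split; first by rewrite /Y mulmxA LAX.
  (* Both products equal [A *m X]; hence [P] commutes with the whole sum and can be moved next to
     [X]. *)
  have cP : GRing.comm P (A *m X).
    by rewrite /GRing.comm -!mulmxE /P -!mulmxA !(mulmxA L) !(mulmxA X) LAX XAL.
  rewrite /Y -!mulmxA.
  suff -> : (\sum_(i < k.+1) (1%:M - A *m X) ^+ i) *m P
            = P *m \sum_(i < k.+1) (1%:M - A *m X) ^+ i by rewrite !mulmxA XAL.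
  symmetry; apply: (@commr_sum 'M[F]_m) => i _; apply: commrX.
  by apply: commrB => //; exact: commr1.
have geo (Z : 'M[F]_m) : (1%:M - Z) *m (\sum_(i < k.+1) Z ^+ i) = 1%:M - Z ^+ k.+1.
  by rewrite -[RHS]opprB subrX1 -mulNr opprB.
rewrite mulmxBr.
have -> : A *m Y = P - D ^+ k.+1.
  have := geo (1%:M - A *m X); rewrite subKr -mulmxA => ->.
  by rewrite (residual_power _ L)// -/P opprD addrA subKr.
by rewrite subKr.
Qed.

(** [L *m A] fixes the range of [L], which is that of [G], and [v - A *m (L *m v)] lies in the null
    space of [L], which is that of [G]. *)
Lemma outer_inverse_absorb (F : fieldType) (m n : nat) (A : 'M[F]_(m, n))
    (G L : 'M[F]_(n, m)) :
  is_outer_inverse A (mxrange G) (mxnull G) L ->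
  L *m A *m G = G /\ G *m A *m L = G.
Proof.
move=> [LAL RL NL].
have ext (B B' : 'M[F]_(n, m)) : (forall v : 'cV_m, B *m v = B' *m v) -> B = B'.
  move=> h; apply/matrixP => i j; have := h (delta_mx j 0).
  by rewrite -!colE => /matrixP/(_ i 0); rewrite !mxE.
split; apply: ext => v.
  have /mem_mxrange[w Gv] : G *m v \in mxrange L.
    by rewrite RL; apply/mem_mxrange; exists v.
  by rewrite -mulmxA Gv mulmxA LAL.
have /mem_mxnull : v - A *m (L *m v) \in mxnull G.
  by rewrite -NL; apply/mem_mxnull; rewrite mulmxBr !mulmxA LAL subrr.
by rewrite mulmxBr => /subr0_eq ->; rewrite !mulmxA.
Qed.

Theorem theorem3p1 (R : realType) (m n r s : nat)
    (A : 'M[R[i]]_(m, n)) (G : 'M[R[i]]_(n, m)) (alpha : R)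
    (A2TS : 'M[R[i]]_(n, m)) :
  \rank A = r -> \rank G = s -> (0 < s)%N -> (s <= r)%N ->
  \rank (G *m A) = \rank G ->
  is_outer_inverse A (mxrange G) (mxnull G) A2TS ->
  alpha != 0 ->
  specnorm (A *m A2TS - A *m (alpha%:C *: G)) < 1 ->
  converges_with_order 18 (pm_iter A (alpha%:C *: G)) A2TS.
Proof.
move=> _ _ _ _ _ outL _; set L := A2TS; set X0 := _ *: G; rewrite -mulmxBr => rho1.
have [LAG GAL] := outer_inverse_absorb _ _ _ _ _ _ outL.
have LAL : L *m A *m L = L by case: outL.
pose X := pm_iter A X0; pose D k := A *m (L - X k).
have [LAX XAL] : (forall k, L *m A *m X k = X k) /\ (forall k, X k *m A *m L = X k).
  apply/all_and2; elim=> [|k [LAX XAL]].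
    by rewrite /X /= /X0 -scalemxAr -!scalemxAl LAG GAL.
  rewrite /X /pm_iter /= -/(pm_iter A X0 k) -/(X k) pm_step_geometric.
  by have [] := geometric_residual A L (X k) 17 LAL LAX XAL.
have DS k : D k.+1 = D k ^+ 18.
  rewrite /D {1}/X /pm_iter /= -/(pm_iter A X0 k) -/(X k) pm_step_geometric.
  by have [] := geometric_residual A L (X k) 17 LAL (LAX k) (XAL k).
have errE k : specnorm (X k - L) = specnorm (L *m D k).
  by rewrite -specnormN opprB /D mulmxA mulmxBr LAL LAX.
pose rho := specnorm (D 0).
have rho0 : 0 <= rho by exact: specnorm_ge0.
(* A crude bound that suffices for convergence: since [rho < 1], the exponent [18 * (k + 1)] may be
   lowered to [k + 2]. *)
have Drho k : specnorm (D k) <= rho ^+ k.+1.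
  elim: k => [|k IH]; first by rewrite expr1.
  rewrite DS (le_trans (specnormX _ _))//.
  rewrite (le_trans (lerXn2r _ _ _ IH)) ?nnegrE ?specnorm_ge0 ?exprn_ge0//.
  by rewrite -exprM ler_wiXn2l// 1?ltW//; lia.
split.
  apply: (@squeeze_cvgr _ _ _ _ (cst 0) (geometric (specnorm L) rho)).
  - near=> k; rewrite specnorm_ge0 errE (le_trans (specnormM _ _))//.
    rewrite ler_wpM2l ?specnorm_ge0// (le_trans (Drho k))//.
    by rewrite exprS ler_piMl ?exprn_ge0// ltW.
  - exact: cvg_cst.
  - by apply: cvg_geometric; rewrite ger0_norm.
(* The product bounds [L *m D k ^+ 18] through [D k = A *m (L - X k)]; the added 1 keeps the
   constant positive even if the product is 0. *)
exists (1 + specnorm L * specnorm A ^+ 18) => [|k].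
  by rewrite ltr_pwDl// mulr_ge0 ?exprn_ge0 ?specnorm_ge0.
rewrite mulrDl mul1r ler_wpDl ?exprn_ge0 ?specnorm_ge0//.
rewrite [leLHS](errE k.+1) DS (le_trans (specnormM _ _))// -mulrA ler_wpM2l ?specnorm_ge0//.
rewrite (le_trans (specnormX _ _))// -exprMn lerXn2r ?nnegrE ?specnorm_ge0//.
  by rewrite mulr_ge0 ?specnorm_ge0.
by rewrite -(specnormN (pm_iter A X0 k - L)) opprB specnormM.
Unshelve. all: by end_near.
Qed.
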